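(* Let $a$ be a complex number (in particular, any integer) and $n\ge1$ an integer. Then $$\det_{0\le i,j\le n-1}\left(\binom{2i+2j+a}{i+1}-\binom{2i+2j+a}{i}\right)=2^{\binom n2}\,\frac{\prod_{i=0}^{n-1}(a+2i-1)}{n!}.$$
   Context: For a complex number $N$ and an integer $k$, the binomial coefficient is $\binom{N}{k}=\frac{N(N-1)\cdots(N-k+1)}{k!}$ if $k\ge0$ and $\binom Nk=0$ if $k<0$. *)

(* Defs.v *)
From mathcomp Require Import all_boot all_order all_algebra.

Set Implicit Arguments.
Unset Strict Implicit.
Unset Printing Implicit Defensive.

Import GRing.Theory.
Local Open Scope ring_scope.

(* In positive characteristic p the value at k >= p is junk: k`! is then not
   invertible. *)
Definition cbinom (F : fieldType) (x : F) (k : int) : F :=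
  match k with
  | Posz m => (\prod_(i < m) (x - i%:R)) / m`!%:R
  | Negz _ => 0
  end.

(* Main.v *)
(* Since binom(N, i+1) - binom(N, i) = (N - 2i - 1) / (i+1) * binom(N, i), the
   (i, j) entry is 1/(i+1) * binom(2i+2j+a, i) * (a+2j-1): pull the outer
   factors out of the rows and columns. Up to the row factor 1/i!, what is left
   is a monic polynomial of degree i in the point 2j, so its determinant is the
   Vandermonde determinant of the points 0, 2, 4, ... *)
Require Import Defs.
From mathcomp Require Import all_boot all_order all_algebra.
From mathcomp Require Import reals.
From mathcomp Require Import complex.
From mathcomp Require Import ring.

Set Implicit Arguments.
Unset Strict Implicit.
Unset Printing Implicit Defensive.

Import GRing.Theory.
Local Open Scope ring_scope.

Lemma det_scale_rows_cols (R : comPzRingType) (n : nat) (r c : 'I_n -> R)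
    (A : 'I_n -> 'I_n -> R) :
  \det (\matrix_(i, j) (r i * A i j * c j)) =
  (\prod_i r i) * \det (\matrix_(i, j) A i j) * (\prod_j c j).
Proof.
have -> : \matrix_(i, j) (r i * A i j * c j) =
          diag_mx (\row_i r i) *m (\matrix_(i, j) A i j) *m diag_mx (\row_j c j).
  by rewrite mul_mx_diag mul_diag_mx; apply/matrixP => i j; rewrite !mxE.
rewrite !det_mulmx !det_diag.
by congr (_ * _ * _); apply: eq_bigr => i _; rewrite mxE.
Qed.

(* The matrix is the product of the unitriangular matrix of coefficients of
   the [p i] with the Vandermonde matrix of the points. *)
Lemma det_monic_horner (R : comNzRingType) (n : nat) (p : 'I_n -> {poly R})
    (x : 'rV[R]_n) :
  (forall i, p i \is monic) -> (forall i : 'I_n, size (p i) = i.+1) ->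
  \det (\matrix_(i, j) (p i).[x 0 j]) = \det (Vandermonde n x).
Proof.
move=> p_monic size_p.
have -> : \matrix_(i, j) (p i).[x 0 j] =
          (\matrix_(i, k) (p i)`_k) *m Vandermonde n x.
  apply/matrixP => i j; rewrite !mxE (@horner_coef_wide _ n) ?size_p //.
  by apply: eq_bigr => k _; rewrite !mxE.
rewrite det_mulmx det_trig; last first.
  apply/is_trig_mxP => i k lt_ik.
  by rewrite mxE nth_default ?size_p.
rewrite big1 ?mul1r // => i _.
by rewrite mxE; have /monicP := p_monic i; rewrite lead_coefE size_p.
Qed.

(** Grouped by the larger index [j], the differences [d * (j - i)] with [i < j] multiply to d^j j!,
    and the exponents of [d] sum to ['C(n, 2)]. *)
Lemma det_Vandermonde_arith (R : comPzRingType) (n : nat) (d : R) :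
  \det (Vandermonde n (\row_(j < n) (d *+ j))) =
  d ^+ 'C(n, 2) * \prod_(j < n) j`!%:R.
Proof.
rewrite det_Vandermonde (exchange_big_dep xpredT) //= -bin2_sum big_mkord.
rewrite -prodrXr -big_split /=; apply: eq_bigr => j _.
transitivity (\prod_(i < n | (i < j)%N) (d * (j - i)%:R)).
  by apply: eq_bigr => i lt_ij; rewrite !mxE mulr_natr mulrnBr // ltnW.
rewrite -(big_ord_widen n (fun i => d * (j - i)%:R)) 1?ltnW //.
by rewrite big_split /= prodr_const card_ord -natr_prod -ffact_prod ffactnn.
Qed.

(** The last factor is (x - m) - (m + 1): its first term raises the lower index to m + 1, its second
    cancels the denominator m + 1. *)
Lemma cbinomS_sub (F : fieldType) (x : F) (m : nat) :
  m.+1%:R != 0 :> F ->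
  cbinom x m.+1%:Z - cbinom x m%:Z =
  (m.+1%:R)^-1 * cbinom x m%:Z * (x - (2 * m)%:R - 1).
Proof.
move=> m1_neq0; rewrite /cbinom big_ord_recr /= factS natrM invfM.
set P := \prod_(_ < _) _; set f := _^-1.
have -> : x - (2 * m)%:R - 1 = (x - m%:R) - m.+1%:R.
  by rewrite mul2n -addnn -[m.+1]addn1 !natrD !opprD !addrA.
by rewrite [RHS]mulrBr [X in _ = _ - X]mulrAC mulVf // mul1r; congr (_ - _); ring.
Qed.

Theorem theorem5 (R : realType) (a : R[i]) (n : nat) (hn : (1 <= n)%N) :
  \det (\matrix_(i < n, j < n)
          (cbinom ((2 * i + 2 * j)%N%:R + a) (i.+1)%:Z
           - cbinom ((2 * i + 2 * j)%N%:R + a) i%:Z))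
  = 2 ^+ 'C(n, 2) * ((\prod_(i < n) (a + (2 * i)%N%:R - 1)) / n`!%:R).
Proof.
(* [p i] is i! binom(X + 2i + a, i), written through its roots k - 2i - a so that monicity and
   degree are immediate. *)
pose p (i : 'I_n) : {poly R[i]} :=
  \prod_(k < i) ('X - (k%:R - (2 * i)%:R - a)%:P).
pose x : 'rV[R[i]]_n := \row_j (2 *+ j).
have natr_neq0 m : (0 < m)%N -> m%:R != 0 :> R[i].
  by rewrite Num.Theory.pnatr_eq0 -lt0n.
transitivity (\det (\matrix_(i < n, j < n)
    ((i.+1%:R)^-1 * (i`!%:R)^-1 * (p i).[x 0 j] * (a + (2 * j)%:R - 1)))).
  congr (\det _); apply/matrixP => i j; rewrite !mxE cbinomS_sub ?natr_neq0 //.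
  congr (_ * _); last by rewrite natrD; ring.
  rewrite -mulrA; congr (_ * _); rewrite /cbinom mulrC; congr (_ * _).
  rewrite horner_prod; apply: eq_bigr => k _.
  rewrite hornerXsubC -mulr_natr; ring.
rewrite det_scale_rows_cols det_monic_horner.
- rewrite det_Vandermonde_arith.
  (* The row factors 1/(i+1) multiply to 1/n!; the factors 1/i! cancel the factorials of the
     Vandermonde determinant. *)
  rewrite big_split /= !prodfV -natr_prod.
  have -> : (\prod_(i < n) i.+1)%N = n`! by rewrite fact_prod big_add1 big_mkord.
  have facts_neq0 : \prod_(i < n) i`!%:R != 0 :> R[i].
    by apply/prodf_neq0 => i _; rewrite natr_neq0 ?fact_gt0.
  by field; rewrite facts_neq0 natr_neq0 ?fact_gt0.
- by move=> i; apply: monic_prod_XsubC.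
- by move=> i; rewrite size_prod_XsubC /index_enum -enumT size_enum_ord.
Qed.
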